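(* Let $M^{1,1}$ be the $n$-dimensional complex Leibniz algebra with basis $e_1,\dots,e_n$ and products $[e_1,e_1]=e_n$, $[e_i,e_1]=e_{i+1}$ for $2\le i\le n-2$, $[e_i,e_2]=e_{i+3}$ for $2\le i\le n-4$ (all other products zero). There is no (non-nilpotent) solvable Leibniz algebra with nilradical $M^{1,1}$.
   Context: All algebras are finite-dimensional over $\mathbb{C}$. A (right) Leibniz algebra is a vector space with a bilinear bracket satisfying $[x,[y,z]]=[[x,y],z]-[[x,z],y]$. With $L^{[1]}=L$, $L^{[s+1]}=[L^{[s]},L^{[s]}]$ and $L^1=L$, $L^{k+1}=[L^k,L]$, the algebra $L$ is solvable if some $L^{[m]}=0$ and nilpotent if some $L^k=0$. The nilradical is the maximal nilpotent ideal.
   Formalization: The dimension is assumed to satisfy n ≥ 6; for 2 ≤ n ≤ 5 no product [e_i,e_2] occurs and the claim is false (e.g. for n = 5 add x with [e_i,x] = e_i for 2 ≤ i ≤ n−1), and for n = 1 the products do not define a Leibniz algebra. *)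

(* Defs.v *)
From HB Require Import structures.
From mathcomp Require Import all_boot all_order all_algebra.
From mathcomp Require Import reals.
From mathcomp Require Export complex.
From mathcomp Require Import zify.

Set Implicit Arguments.
Unset Strict Implicit.
Unset Printing Implicit Defensive.

Import GRing.Theory.

Local Open Scope ring_scope.

(* Finite-dimensional right Leibniz algebras: every right multiplication
   y |-> [y, z] is a derivation. *)

HB.mixin Record Vector_isLeibniz (F : fieldType) (L : Type)
    of Vector F L := {
  leib : L -> L -> L;
  leib_bilinear : bilinear_for *:%R *:%R leib;
  leib_identity : forall x y z : L,
    leib x (leib y z) = leib (leib x y) z - leib (leib x z) y }.

#[short(type="leibnizAlgType")]
HB.structure Definition LeibnizAlg (F : fieldType) :=
  { L of Vector F L & Vector_isLeibniz F L }.

Reserved Notation "⁅ x , y ⁆" (at level 0, x at level 99, y at level 99,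
  format "⁅ x ,  y ⁆").
Notation "⁅ x , y ⁆" := (leib x y) : ring_scope.

Section LeibnizTheory.

Variables (F : fieldType) (L : leibnizAlgType F).
Implicit Types (x y z : L) (U V W I N : {vspace L}).

HB.instance Definition _ :=
  bilinear_isBilinear.Build F L L L *:%R *:%R leib leib_bilinear.

(* The span of all brackets [u, v] with u in U and v in V; see leibvP. *)
Definition leibv U V : {vspace L} :=
  <<[seq ⁅u, v⁆ | u <- vbasis U, v <- vbasis V]>>%VS.

Lemma leibvP U V W :
  (forall u v, u \in U -> v \in V -> ⁅u, v⁆ \in W) <-> (leibv U V <= W)%VS.
Proof.
split=> [sUVW | sUVW u v Uu Vv].
  apply/span_subvP=> _ /allpairsP[[u v] /= [Uu Vv ->]].
  by rewrite sUVW ?vbasis_mem.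
apply: (subvP sUVW).
rewrite (coord_vbasis Uu) linear_sumlz memv_suml // => i _.
rewrite linearZl_LR memvZ // (coord_vbasis Vv) linear_sumr memv_suml // => j _.
rewrite linearZr_LR memvZ // memv_span //.
by apply/allpairsP; exists ((vbasis U)`_i, (vbasis V)`_j); rewrite !mem_nth ?size_tuple.
Qed.

(* leib_derived U s and leib_lower U s are U^[s+1] and U^{s+1}: the indexing
   starts at 0. *)
Definition leib_derived U (s : nat) : {vspace L} :=
  iter s (fun V => leibv V V) U.

Definition leib_lower U (s : nat) : {vspace L} :=
  iter s (fun V => leibv V U) U.

Definition leib_solvable U : Prop := exists s, leib_derived U s = 0%VS.

Definition leib_nilpotent U : Prop := exists s, leib_lower U s = 0%VS.

Definition leib_ideal I : Prop :=
  (leibv I fullv <= I)%VS /\ (leibv fullv I <= I)%VS.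

Definition is_nilradical N : Prop :=
  [/\ leib_ideal N, leib_nilpotent N &
      forall I, leib_ideal I -> leib_nilpotent I -> (N <= I)%VS -> I = N].

End LeibnizTheory.

(* The subspace N is closed under the bracket, and as a Leibniz algebra it is
   isomorphic to A. *)
Definition leib_isom (F : fieldType) (A L : leibnizAlgType F)
    (N : {vspace L}) : Prop :=
  exists f : 'Hom(A, L),
    [/\ lker f = 0%VS, limg f = N & forall x y, f ⁅x, y⁆ = ⁅f x, f y⁆].

Section M11.

Variables (F : fieldType) (n : nat).

(* e_k is numbered from 1, so it sits at the ordinal of value k - 1. *)
Definition M11_e (k : nat) : 'rV[F]_n := \row_(j < n) (j.+1 == k)%:R.

Definition M11_table (i j : nat) : 'rV[F]_n :=
  if (i == 1)%N && (j == 1)%N then M11_e n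
  else if (2 <= i <= n - 2)%N && (j == 1)%N then M11_e i.+1
  else if (2 <= i <= n - 4)%N && (j == 2)%N then M11_e (i + 3)
  else 0.

Definition M11_bracket (u v : 'rV[F]_n) : 'rV[F]_n :=
  \sum_(i < n) \sum_(j < n) (u 0 i * v 0 j) *: M11_table i.+1 j.+1.

Lemma M11_bilinear : bilinear_for *:%R *:%R M11_bracket.
Proof.
split=> w a u v; rewrite /M11_bracket /= scaler_sumr -big_split;
  apply: eq_bigr => i _; rewrite scaler_sumr -big_split; apply: eq_bigr => j _;
  rewrite /= !mxE.
  by rewrite mulrDl scalerDl scalerA mulrA.
by rewrite mulrDr scalerDl scalerA mulrCA.
Qed.

HB.instance Definition _ := bilinear_isBilinear.Build F 'rV[F]_n 'rV[F]_n
  'rV[F]_n *:%R *:%R M11_bracket M11_bilinear.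

Lemma M11_bracket_e i j : (0 < i <= n)%N -> (0 < j <= n)%N ->
  M11_bracket (M11_e i) (M11_e j) = M11_table i j.
Proof.
case: i j => [|i] [|j] //= lti ltj; rewrite /M11_bracket.
rewrite (bigD1 (Ordinal lti)) //= [X in _ + X]big1 => [|k neq]; last first.
  rewrite big1 // => l _; rewrite mxE eqSS.
  have /negPf-> : nat_of_ord k != i by [].
  by rewrite mul0r scale0r.
rewrite addr0 (bigD1 (Ordinal ltj)) //= big1 => [|l neq].
  by rewrite addr0 !mxE !eqxx mulr1 scale1r.
rewrite !mxE !eqSS; have /negPf-> : nat_of_ord l != j by [].
by rewrite mulr0 scale0r.
Qed.

Lemma M11_ext (f : {bilinear 'rV[F]_n -> 'rV[F]_n -> 'rV[F]_n}) :
    (forall i j k : 'I_n, let a := M11_e i.+1 in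
      let b := M11_e j.+1 in let c := M11_e k.+1 in
      f a (f b c) = f (f a b) c - f (f a c) b) ->
  forall x y z, f x (f y z) = f (f x y) z - f (f x z) y.
Proof.
move=> basis x y z.
have rV_sum (u : 'rV[F]_n) : u = \sum_(i < n) u 0 i *: M11_e i.+1.
  rewrite [LHS]row_sum_delta; apply: eq_bigr => i _; congr (_ *: _).
  by apply/rowP=> j; rewrite !mxE eqxx eqSS.
rewrite (rV_sum x) !linear_sumlz -sumrB; apply: eq_bigr => i _.
rewrite !linearZl_LR -scalerBr; congr (_ *: _).
rewrite (rV_sum y) linear_sumlz !linear_sumr linear_sumlz -sumrB.
apply: eq_bigr => j _.
rewrite linearZl_LR !linearZr_LR linearZl_LR -scalerBr; congr (_ *: _).
rewrite (rV_sum z) !linear_sumr linear_sumlz -sumrB; apply: eq_bigr => k _.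
rewrite !linearZr_LR linearZl_LR -scalerBr; congr (_ *: _).
exact: basis.
Qed.

Lemma M11_identity (n6 : (6 <= n)%N) (x y z : 'rV[F]_n) :
  M11_bracket x (M11_bracket y z) =
  M11_bracket (M11_bracket x y) z - M11_bracket (M11_bracket x z) y.
Proof.
have tab0 p q : (0 < p <= n)%N -> (2 < q <= n)%N ->
    M11_bracket (M11_e p) (M11_e q) = 0.
  move=> hp hq; rewrite M11_bracket_e //; last by lia.
  by rewrite /M11_table; do 3 (case: ifP => [|_]; first by lia).
have basis a b c : (0 < a <= n)%N -> (0 < b <= n)%N -> (0 < c <= n)%N ->
    M11_bracket (M11_e a) (M11_bracket (M11_e b) (M11_e c)) =
    M11_bracket (M11_bracket (M11_e a) (M11_e b)) (M11_e c)
    - M11_bracket (M11_bracket (M11_e a) (M11_e c)) (M11_e b).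
  move=> la lb lc; rewrite !(M11_bracket_e _ _) //.
  have -> : M11_bracket (M11_e a) (M11_table b c) = 0.
    rewrite /M11_table; do 3 (case: ifP => [?|_]; first by apply: tab0; lia).
    by rewrite linear0r.
  rewrite /M11_table.
  case: ifP => h1; [|case: ifP => h2; [|case: ifP => h3]];
  (case: ifP => k1; [|case: ifP => k2; [|case: ifP => k3]]);
  rewrite ?linear0l ?M11_bracket_e; try lia; rewrite /M11_table;
  repeat (case: ifP => ?); try (exfalso; lia); rewrite ?subrr //.
  all: try by apply/esym/eqP; rewrite subr_eq0; apply/eqP; congr M11_e; lia.
apply: (M11_ext (f := M11_bracket)) => i j k a b c.
by apply: basis; rewrite /= ltn_ord.
Qed.

End M11.

(* The hypothesis is a parameter of the type because the table does not satisfy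
   the Leibniz identity for every n (it fails for n = 1), and for n < 6 it has
   no product [e_i, e_2]. *)
Definition M11 (F : fieldType) (n : nat) (n6 : (6 <= n)%N) : Type := 'rV[F]_n.

Section M11Instance.

Variables (F : fieldType) (n : nat) (n6 : (6 <= n)%N).

HB.instance Definition _ := Vector.on (M11 F n6).
HB.instance Definition _ := Vector_isLeibniz.Build F (M11 F n6)
  (@M11_bilinear F n) (@M11_identity F n n6).

End M11Instance.

(* Main.v *)
Require Import Defs.
From mathcomp Require Import all_boot all_order all_algebra reals complex.
From mathcomp Require Import zify ring.

Set Implicit Arguments.
Unset Strict Implicit.
Unset Printing Implicit Defensive.

Import GRing.Theory Num.Theory.

Local Open Scope ring_scope.

(** Right multiplication by any x in L induces a derivation of the nilradical
    N = M^{1,1}.  Comparing coefficients, the derivation acts on N / [N, N],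
    spanned by the classes of e_1 and e_2, as diag(a, 3a).  The element
    [e_2, x] + [x, e_2] is annihilated by all left multiplications, while
    [e_2, e_2] = e_5 <> 0, so [x, e_2] has e_2-coefficient -3a; but
    0 = [x, [e_1, e_2]] = [[x, e_1], e_2] - [[x, e_2], e_1] has e_3-coefficient
    3a, whence a = 0 and [N, L] <= [N, N].  It follows that [N^k, L] <= N^{k+1}.
    If some derived ideal of L were not contained in N, then adding N to the
    last such one would give an ideal I with [I, I] <= N, hence nilpotent, and
    strictly larger than N.  So L = N. *)

(** * Ideals, derived and lower central series of Leibniz algebras *)

Section Ideals.

Variables (F : fieldType) (L : leibnizAlgType F).
Implicit Types (x y z : L) (U V W I N : {vspace L}).

Lemma leib_derivation x y z : ⁅⁅x, y⁆, z⁆ = ⁅x, ⁅y, z⁆⁆ + ⁅⁅x, z⁆, y⁆.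
Proof. by rewrite leib_identity subrK. Qed.

Lemma mem_leibv U V u v : u \in U -> v \in V -> ⁅u, v⁆ \in leibv U V.
Proof. by move: u v; apply/leibvP. Qed.

Lemma leibvS U U' V V' :
  (U <= U')%VS -> (V <= V')%VS -> (leibv U V <= leibv U' V')%VS.
Proof.
move=> /subvP sU /subvP sV; apply/leibvP => u v Uu Vv.
by rewrite mem_leibv ?sU ?sV.
Qed.

Lemma leibv_addvl U V W W' :
  (leibv U W <= W')%VS -> (leibv V W <= W')%VS -> (leibv (U + V) W <= W')%VS.
Proof.
move=> /leibvP UW /leibvP VW; apply/leibvP => _ w /memv_addP[u Uu [v Vv ->]] Ww.
by rewrite linearDl; apply: memvD; [apply: UW | apply: VW].
Qed.

Lemma leibv_addvr U V W W' :
  (leibv W U <= W')%VS -> (leibv W V <= W')%VS -> (leibv W (U + V) <= W')%VS.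
Proof.
move=> /leibvP WU /leibvP WV; apply/leibvP => w _ Ww /memv_addP[u Uu [v Vv ->]].
by rewrite linearDr; apply: memvD; [apply: WU | apply: WV].
Qed.

Lemma leib_idealP I :
  leib_ideal I <->
  (forall x y, x \in I -> ⁅x, y⁆ \in I) /\ (forall x y, y \in I -> ⁅x, y⁆ \in I).
Proof.
rewrite /leib_ideal -!leibvP; split=> -[Il Ir]; split=> x y.
- by move=> Ix; rewrite Il ?memvf.
- by move=> Iy; rewrite Ir ?memvf.
- by move=> Ix _; apply: Il.
- by move=> _; apply: Ir.
Qed.

Lemma leib_ideal_full : leib_ideal (fullv : {vspace L}).
Proof. by rewrite /leib_ideal !subvf. Qed.

Lemma leib_idealD I N : leib_ideal I -> leib_ideal N -> leib_ideal (I + N).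
Proof.
move=> [I1 I2] [N1 N2]; split.
  by apply: leibv_addvl; [apply: subv_trans I1 _ | apply: subv_trans N1 _];
    rewrite ?addvSl ?addvSr.
by apply: leibv_addvr; [apply: subv_trans I2 _ | apply: subv_trans N2 _];
  rewrite ?addvSl ?addvSr.
Qed.

(** The preimage of [W] under [g] is a subspace, so testing it on brackets suffices. *)
Lemma leibv_linear_ind (V' : vectType F) (g : {linear L -> V'}) U V
    (W : {vspace V'}) :
    (forall u v, u \in U -> v \in V -> g ⁅u, v⁆ \in W) ->
  forall w, w \in leibv U V -> g w \in W.
Proof.
move=> gW w; have /subvP sUV : (leibv U V <= linfun g @^-1: W)%VS.
  by apply/leibvP => u v Uu Vv; rewrite -memv_preim lfunE gW.
by move/sUV; rewrite -memv_preim lfunE.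
Qed.

Lemma leibv_mulr_ind x U V W :
    (forall u v, u \in U -> v \in V -> ⁅⁅u, v⁆, x⁆ \in W) ->
  forall w, w \in leibv U V -> ⁅w, x⁆ \in W.
Proof. exact: (leibv_linear_ind (g := applyr leib x)). Qed.

Lemma leibv_mull_ind x U V W :
    (forall u v, u \in U -> v \in V -> ⁅x, ⁅u, v⁆⁆ \in W) ->
  forall w, w \in leibv U V -> ⁅x, w⁆ \in W.
Proof.
exact: (leibv_linear_ind (g := (leib : {bilinear L -> L -> L}) x)).
Qed.

Lemma leib_ideal_leibv I : leib_ideal I -> leib_ideal (leibv I I).
Proof.
move=> /leib_idealP[Il Ir]; apply/leib_idealP; split=> [w x | x w].
  apply: leibv_mulr_ind => u v Iu Iv.
  by rewrite leib_derivation memvD ?mem_leibv ?Il.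
apply: leibv_mull_ind => u v Iu Iv.
by rewrite leib_identity memvB ?mem_leibv ?Ir.
Qed.

Lemma leib_ideal_derived s : leib_ideal (leib_derived (fullv : {vspace L}) s).
Proof.
elim: s => [|s IHs]; first exact: leib_ideal_full.
exact: leib_ideal_leibv.
Qed.

Lemma mem_leib_lowerS U s u v :
  u \in leib_lower U s -> v \in U -> ⁅u, v⁆ \in leib_lower U s.+1.
Proof. exact: mem_leibv. Qed.

(** For [y] in [leib_lower N k] and [u] in [N], [⁅⁅y, u⁆, x⁆] splits into [⁅y, ⁅u, x⁆⁆] and
    [⁅⁅y, x⁆, u⁆]. Induction handles the second; in the first [⁅u, x⁆] lies in [leibv N N], and by
    the Leibniz identity bracketing with such an element descends two steps. *)
Lemma leib_lower_derivation N :
    (leibv N fullv <= leibv N N)%VS ->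
  forall k, (leibv (leib_lower N k) fullv <= leib_lower N k.+1)%VS.
Proof.
move=> /leibvP N2; elim=> [|k /leibvP IHk]; first exact/leibvP.
have lowN2 y w : y \in leib_lower N k -> w \in leibv N N ->
    ⁅y, w⁆ \in leib_lower N k.+2.
  move=> yk; apply: leibv_mull_ind => u v Nu Nv.
  by rewrite leib_identity memvB ?mem_leib_lowerS.
apply/leibvP => w x + _; apply: leibv_mulr_ind => y u yk Nu.
rewrite leib_derivation; apply: memvD; first by rewrite lowN2 ?N2 ?memvf.
by rewrite mem_leib_lowerS ?IHk ?memvf.
Qed.

Lemma nilradical_full N :
    leib_solvable (fullv : {vspace L}) -> is_nilradical N ->
    (leibv N fullv <= leibv N N)%VS ->
  N = fullv.
Proof.
move=> [m Lm0] [Nid [c Nc0] Nmax] N2.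
(* The inclusion holds at [s = m], where the derived ideal is 0; the induction carries it down to
   [s = 0], where that ideal is all of [L]. *)
suff sN s : (leib_derived (fullv : {vspace L}) s <= N)%VS ->
    (fullv : {vspace L}) = N.
  by rewrite -(sN m) // Lm0 sub0v.
elim: s => [|s IHs] sN; first by apply/eqP; rewrite eqEsubv subvf andbT.
apply: IHs; set D := leib_derived _ s in sN *.
have Did : leib_ideal D := leib_ideal_derived s.
have [[Nl Nr] IN] := (Nid, leib_idealD Did Nid).
suff <- : (D + N)%VS = N by apply: addvSl.
apply: Nmax; [by [] | | exact: addvSr].
(* The lower series of [D + N] runs one step behind that of [N]: the first bracket only lands in
   [N], and from there bracketing with anything in [L] descends one step. *)
have low k : (leib_lower (D + N) k.+1 <= leib_lower N k)%VS.
  elim: k => [|k IHk] /=.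
    apply: leibv_addvl; last exact: subv_trans (leibvS (subvv _) (subvf _)) Nl.
    apply: leibv_addvr; first exact: sN.
    exact: subv_trans (leibvS (subvf _) (subvv _)) Nr.
  apply: subv_trans (leibvS IHk (subvf _)) _.
  exact: leib_lower_derivation.
by exists c.+1; apply/eqP; rewrite -subv0 -Nc0.
Qed.

End Ideals.

(** * Coefficients of brackets and of outer multiplications on [M11] *)

Section M11Coordinates.

Variables (F : fieldType) (n : nat) (n6 : (6 <= n)%N).
Implicit Types u v : 'rV[F]_n.

(* The coefficient of e_k, numbered from 1, with the junk value 0 for k = 0 and
   for k > n. *)
Definition M11_coord k u : F := \sum_(i < n | i.+1 == k) u 0 i.

Lemma M11_coord_ord u (i : 'I_n) : M11_coord i.+1 u = u 0 i.
Proof. by rewrite /M11_coord (big_pred1 i). Qed.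

Lemma M11_coordD k u v : M11_coord k (u + v) = M11_coord k u + M11_coord k v.
Proof. by rewrite -big_split; apply: eq_bigr => i _; rewrite mxE. Qed.

Lemma M11_coordN k u : M11_coord k (- u) = - M11_coord k u.
Proof. by rewrite -sumrN; apply: eq_bigr => i _; rewrite mxE. Qed.

Lemma M11_coord0 k : M11_coord k (0 : 'rV[F]_n) = 0.
Proof. by rewrite /M11_coord big1 // => i _; rewrite mxE. Qed.

Lemma M11_coord_e k l : (0 < k <= n)%N -> M11_coord k (M11_e F n l) = (k == l)%:R.
Proof.
by case: k => [|k] // ltk; rewrite (M11_coord_ord _ (Ordinal ltk)) mxE.
Qed.

Lemma sum_pair_delta u v a b : (0 < a <= n)%N -> (0 < b <= n)%N ->
  \sum_(i < n) \sum_(j < n) u 0 i * v 0 j * ((i.+1 == a) && (j.+1 == b))%:R =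
  M11_coord a u * M11_coord b v.
Proof.
case: a b => [|a] [|b] // lta ltb.
rewrite (M11_coord_ord _ (Ordinal lta)) (M11_coord_ord _ (Ordinal ltb)).
rewrite (bigD1 (Ordinal lta)) //= (bigD1 (Ordinal ltb)) //= !eqxx mulr1.
rewrite !big1 ?addr0 // => [i ne_ia | j ne_jb].
  have /negPf ne : i.+1 != a.+1 by rewrite eqSS.
  by rewrite big1 // => j _; rewrite ne mulr0.
have /negPf ne : j.+1 != b.+1 by rewrite eqSS.
by rewrite ne andbF mulr0.
Qed.

Lemma M11_coord_bracket k u v : (0 < k <= n)%N ->
  M11_coord k (M11_bracket u v) =
  \sum_(i < n) \sum_(j < n) u 0 i * v 0 j * M11_coord k (M11_table F n i.+1 j.+1).
Proof.
case: k => [|k] // ltk; rewrite (M11_coord_ord _ (Ordinal ltk)) summxE.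
apply: eq_bigr => i _; rewrite summxE; apply: eq_bigr => j _.
by rewrite mxE (M11_coord_ord _ (Ordinal ltk)).
Qed.

(** Both families of products stop at [e_{n-1}], so [e_n] arises only from [[e_1, e_1]]. The guard
    [4 < k] is the bound [2 <= i] for [i = k - 3]. *)
Lemma M11_coord_table k i j : (2 < k <= n)%N ->
  M11_coord k (M11_table F n i j) =
  if k == n then ((i == 1)%N && (j == 1)%N)%:R
  else ((i == k.-1)%N && (j == 1)%N)%:R
       + [&& 4 < k, i == k - 3 & j == 2]%N%:R.
Proof.
move=> hk; have -> : M11_coord k (M11_table F n i j) =
  (if k == n then (i == 1) && (j == 1)
   else (i == k.-1) && (j == 1) || [&& 4 < k, i == k - 3 & j == 2])%N%:R.
  rewrite /M11_table; do 3 (case: ifP => ?;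
    first by rewrite M11_coord_e;
      [congr (nat_of_bool _)%:R; case: ifP; lia | lia]).
  by rewrite M11_coord0 -[LHS]/(false%:R); congr (nat_of_bool _)%:R; case: ifP; lia.
(* The alternatives [j = 1] and [j = 2] exclude each other, so the disjunction is a sum. *)
case: ifP => // _; rewrite -natrD; congr _%:R.
by case: j => [|[|[|j]]]; rewrite ?andbF ?andbT ?orbF ?addn0.
Qed.

Lemma M11_coordn u v :
  M11_coord n (M11_bracket u v) = M11_coord 1 u * M11_coord 1 v.
Proof.
rewrite M11_coord_bracket -?sum_pair_delta; try lia.
apply: eq_bigr => i _; apply: eq_bigr => j _.
by rewrite M11_coord_table ?eqxx //; lia.
Qed.

Lemma M11_coord_mul k u v : (2 < k < n)%N ->
  M11_coord k (M11_bracket u v) =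
  M11_coord k.-1 u * M11_coord 1 v
  + (if (4 < k)%N then M11_coord (k - 3)%N u * M11_coord 2 v else 0).
Proof.
move=> hk; rewrite M11_coord_bracket; last by lia.
have tab i j := @M11_coord_table k i j.
case: ifP => k4; rewrite -!sum_pair_delta; try lia.
  rewrite -big_split; apply: eq_bigr => i _ /=.
  rewrite -big_split; apply: eq_bigr => j _ /=.
  by rewrite tab; [rewrite k4 ifN ?mulrDr //; lia | lia].
rewrite addr0; apply: eq_bigr => i _; apply: eq_bigr => j _.
by rewrite tab; [rewrite k4 ifN ?addr0 //; lia | lia].
Qed.

(* For an extension L of M11, the functions D and T are the restrictions to M11
   of the right and left multiplications by an element of L. *)
Lemma M11_outer_coord (D T : 'rV[F]_n -> 'rV[F]_n) :
    (3%:R : F) != 0 ->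
    (forall y z, D (M11_bracket y z) =
                 M11_bracket (D y) z + M11_bracket y (D z)) ->
    (forall y z, T (M11_bracket y z) =
                 M11_bracket (T y) z - M11_bracket (T z) y) ->
    (forall y z, M11_bracket y (D z) + M11_bracket y (T z) = 0) ->
  forall i j, (0 < i <= 2)%N -> (0 < j <= 2)%N ->
    M11_coord i (D (M11_e F n j)) = 0.
Proof.
move=> neq30 DM TM DT; set e := M11_e F n.
have ce k l : (0 < k <= n)%N -> M11_coord k (e l) = (k == l)%:R.
  exact: M11_coord_e.
have mule i j : (0 < i <= n)%N -> (0 < j <= n)%N ->
    M11_bracket (e i) (e j) = M11_table F n i j by exact: M11_bracket_e.
have e12 : M11_bracket (e 1) (e 2) = 0.
  by rewrite mule; try lia; rewrite /M11_table; repeat (case: ifP; try lia).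
have e21 i : (2 <= i <= 4)%N -> M11_bracket (e i) (e 1) = e i.+1.
  move=> hi; rewrite mule; try lia.
  by rewrite /M11_table; repeat (case: ifP; try lia).
have e22 : M11_bracket (e 2) (e 2) = e 5.
  by rewrite mule; try lia; rewrite /M11_table; repeat (case: ifP; try lia).
have m0 : M11_bracket 0 0 = 0 :> 'rV[F]_n by rewrite linear0l.
have D0 : D 0 = 0 by rewrite -[in LHS]m0 DM linear0l linear0r addr0.
have T0 : T 0 = 0 by rewrite -[in LHS]m0 TM subrr.
have c3 u v : M11_coord 3 (M11_bracket u v) = M11_coord 2 u * M11_coord 1 v.
  by rewrite M11_coord_mul ?addr0 //; lia.
have c4 u v : M11_coord 4 (M11_bracket u v) = M11_coord 3 u * M11_coord 1 v.
  by rewrite M11_coord_mul ?addr0 //; lia.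
have c5 u v : M11_coord 5 (M11_bracket u v) =
    M11_coord 4 u * M11_coord 1 v + M11_coord 2 u * M11_coord 2 v.
  by rewrite M11_coord_mul //; lia.
have coefs := (c3, c4, c5, M11_coordn, M11_coordD, M11_coordN, M11_coord0).
(* Here the [e_5]-coefficient is the [e_2]-coefficient of [D e_1], and the [e_n]-coefficient is the
   [e_1]-coefficient of [D e_2]; so both off-diagonal entries vanish. *)
have De12 : M11_bracket (D (e 1)) (e 2) + M11_bracket (e 1) (D (e 2)) = 0.
  by rewrite -DM e12 D0.
have D12 : M11_coord 2 (D (e 1)) = 0.
  move/(congr1 (M11_coord 5)): De12; rewrite !coefs !ce; try lia.
  by rewrite /= !(mul0r, mulr0, mulr1, mul1r, add0r, addr0).
have D21 : M11_coord 1 (D (e 2)) = 0.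
  move/(congr1 (M11_coord n)): De12; rewrite !coefs !ce; try lia.
  by rewrite /= !(mul0r, mulr0, mulr1, mul1r, add0r, addr0).
(* Since [[e_2, e_2] = e_5], the relation [DT] makes the [e_2]-coefficients of [D e_2] and [T e_2]
   opposite; applying [T] to [[e_1, e_2] = 0] kills the latter. *)
have D22 : M11_coord 2 (D (e 2)) = 0.
  have Te2 : M11_coord 2 (T (e 2)) = 0.
    have := TM (e 1) (e 2); rewrite e12 T0 => /(congr1 (M11_coord 3)).
    rewrite !coefs !ce; try lia.
    by rewrite /= !(mul0r, mulr0, mulr1, mul1r, add0r, addr0) => /esym/eqP;
      rewrite oppr_eq0 => /eqP.
  move/(congr1 (M11_coord 5)): (DT (e 2) (e 2)); rewrite !coefs !ce; try lia.
  by rewrite /= Te2 !(mul0r, mulr0, mulr1, mul1r, add0r, addr0).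
have D11 : M11_coord 1 (D (e 1)) = 0.
  (* With [a], [d] the diagonal entries of [D], [e_5 = [e_2, e_2]] gives [D e_5] the
     [e_5]-coefficient [2d], while [e_5 = [[[e_2, e_1], e_1], e_1]] gives [d + 3a]. Hence
     [3a = d = 0]. *)
  move/(congr1 (M11_coord 5)): (DM (e 2) (e 2)).
  rewrite e22 -[e 5]e21 // DM -[e 4]e21 // DM -[e 3]e21 // DM !coefs !ce; try lia.
  rewrite /= D12 D21 D22 => /eqP.
  rewrite -subr_eq0 (_ : _ - _ = 3%:R * M11_coord 1 (D (e 1))); last by ring.
  by rewrite mulf_eq0 (negPf neq30) => /eqP.
by move=> [|[|[|i]]] [|[|[|j]]].
Qed.

End M11Coordinates.

(** * Transfer to an ideal isomorphic to [M11], and the conclusion *)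

Section M11Ideal.

Variables (F : fieldType) (n : nat) (n6 : (6 <= n)%N).
Local Notation A := (M11 F n6).

Lemma M11_e_leibv k : (2 < k <= n)%N ->
  (M11_e F n k : A) \in leibv (fullv : {vspace A}) fullv.
Proof.
move=> hk; have [i hi ->] : exists2 i, (0 < i <= n)%N &
    (M11_e F n k : A) = ⁅M11_e F n i : A, M11_e F n 1 : A⁆.
  have [->|ne_kn] := eqVneq k n; [exists 1%N | exists k.-1]; try lia.
    by rewrite [RHS]M11_bracket_e /M11_table ?eqxx //; lia.
  rewrite [RHS]M11_bracket_e; try lia; rewrite /M11_table.
  by do 2 (case: ifP => ?; first by [lia | rewrite prednK //; lia]); lia.
by rewrite mem_leibv ?memvf.
Qed.

(** All basis vectors beyond [e_2] are brackets, so modulo [[A, A]] only [e_1] and [e_2] have to be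
    controlled. *)
Lemma M11_decomposition (u : A) :
  exists2 w, w \in leibv (fullv : {vspace A}) fullv &
  u = M11_coord 1 (u : 'rV_n) *: (M11_e F n 1 : A)
      + M11_coord 2 (u : 'rV_n) *: (M11_e F n 2 : A) + w.
Proof.
have i0 : (0 < n)%N by lia.
have i1 : (1 < n)%N by lia.
exists (\sum_(i < n | (2 < i.+1)%N) (u : 'rV_n) 0 i *: (M11_e F n i.+1 : A)).
  apply: memv_suml => i hi; rewrite memvZ // M11_e_leibv //.
  by rewrite hi ltn_ord.
rewrite (M11_coord_ord _ (Ordinal i0)) (M11_coord_ord _ (Ordinal i1)).
have rV_sum : u = \sum_(i < n) (u : 'rV_n) 0 i *: (M11_e F n i.+1 : A).
  rewrite [LHS](@row_sum_delta F n u); apply: eq_bigr => i _; congr (_ *: _).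
  by apply/rowP=> j; rewrite !mxE eqxx eqSS.
rewrite [LHS]rV_sum (bigD1 (Ordinal i0)) //= (bigD1 (Ordinal i1)) //= addrA.
by congr (_ + _); apply: eq_bigl => i; rewrite -!val_eqE /=; lia.
Qed.

Variables (L : leibnizAlgType F) (N : {vspace L}).

Lemma M11_ideal_leibv :
    (3%:R : F) != 0 -> leib_ideal N -> leib_isom A N ->
  (leibv N fullv <= leibv N N)%VS.
Proof.
move=> neq30 Nid [f [/eqP/lker0P f_inj fN fM]].
have /leib_idealP[Nl Nr] := Nid; have /leib_idealP[N2l _] := leib_ideal_leibv Nid.
have fmem y : f y \in N by rewrite -fN memv_img ?memvf.
have fV z : z \in N -> f (f^-1%VF z) = z by rewrite -fN => /limg_lfunVK.
have f2 w : w \in leibv (fullv : {vspace A}) fullv -> f w \in leibv N N.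
  by apply: leibv_linear_ind => u v _ _ /=; rewrite fM mem_leibv.
apply/leibvP => z x Nz _.
(* [f^-1%VF] inverts [f] only on its image [N]; both products stay there because [N] is an ideal. *)
pose D y := f^-1%VF ⁅f y, x⁆; pose T y := f^-1%VF ⁅x, f y⁆.
have fD y : f (D y) = ⁅f y, x⁆ by rewrite fV ?Nl.
have fT y : f (T y) = ⁅x, f y⁆ by rewrite fV ?Nr.
have DM y y' : D ⁅y, y'⁆ = ⁅D y, y'⁆ + ⁅y, D y'⁆.
  by apply: f_inj; rewrite linearD /= !fD !fM !fD leib_derivation addrC.
have TM y y' : T ⁅y, y'⁆ = ⁅T y, y'⁆ - ⁅T y', y⁆.
  by apply: f_inj; rewrite linearB /= !fT !fM !fT leib_identity.
(* The right side of the Leibniz identity changes sign when its last two arguments are exchanged. *)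
have DT y y' : ⁅y, D y'⁆ + ⁅y, T y'⁆ = 0.
  apply: f_inj; rewrite linearD linear0 /= !fM fD fT !leib_identity.
  by rewrite addrC addrA subrK subrr.
have Dcoord := M11_outer_coord n6 neq30 DM TM DT.
have De k : (0 < k <= 2)%N -> ⁅f (M11_e F n k : A), x⁆ \in leibv N N.
  move=> hk; rewrite -fD.
  have [w /f2 + ->] := M11_decomposition (D (M11_e F n k)).
  by rewrite !Dcoord // !scale0r !add0r.
rewrite -(fV z Nz); have [w w2 ->] := M11_decomposition (f^-1%VF z).
rewrite !linearD !linearZ !linearDl !linearZl_LR.
by rewrite !memvD ?memvZ ?De ?N2l ?f2.
Qed.

End M11Ideal.

Theorem theorem3p6 (R : realType) (n : nat) (n6 : (6 <= n)%N) :
  ~ exists (L : leibnizAlgType R[i]) (N : {vspace L}),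
      [/\ leib_solvable (fullv : {vspace L}),
          ~ leib_nilpotent (fullv : {vspace L}),
          is_nilradical N
        & leib_isom (M11 R[i] n6) N].
Proof.
move=> [L [N [solL not_nilL nilradN isoN]]]; have [Nid nilN _] := nilradN.
apply: not_nilL; rewrite -(nilradical_full solL nilradN) //.
by apply: M11_ideal_leibv Nid isoN; rewrite pnatr_eq0.
Qed.
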